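(* (Class Ia solution with $A=\frac12$: regularity and energy conditions.) Let $a>0$, $m$, $q\neq0$ be real numbers with $1-\frac{2m}{a}+\frac{q^2}{a^2}>0$, $m>\frac{q^2}{a}$ and $\left(\frac mq\right)^2-1=\frac12\left(\frac mq-\frac qa\right)^2$. Define $R,D>0$ and $F$ by $$\frac1{R^2}=\frac2{a^3}\left(m-\frac{q^2}{2a}\right),\qquad D=\frac{2|q|}{a^3},\qquad \sqrt2\left(F-DR^2\left(1-\frac{a^2}{R^2}\right)^{1/2}\right)=\ln\left(1-\frac{2m}{a}+\frac{q^2}{a^2}\right),$$ and on $0\le r\le a$ let $$e^{-\alpha}=1-\frac{r^2}{R^2},\qquad \omega=\sqrt2\left(F-DR^2\left(1-\frac{r^2}{R^2}\right)^{1/2}\right),\qquad Q=\pm\frac{Dr^3}2,$$ $$\kappa\rho=\frac3{R^2}-\frac{D^2r^2}4,\qquad \kappa p=-\frac1{R^2}+\frac{D^2r^2}4+\sqrt2\,D\left(1-\frac{r^2}{R^2}\right)^{1/2}.$$ Then this solution is non-singular and has no horizons ($e^\omega>0$) on $0\le r\le a$, satisfies the regularity conditions $\alpha'(0)=\omega'(0)=p'(0)=0$, and satisfies throughout $0\le r\le a$ the energy conditions: (i) $-T^4{}_4\ge0$; (ii) $p+\rho\ge0$ (weak energy condition); (iii) $T^k{}_k-T^4{}_4\ge0$, $k$ summed over $1,2,3$ (strong energy condition); (iv) $\rho\ge0$; (v) $p\ge0$; (vi) $3p+\rho\ge0$; (vii) $p'\le0$; (viii) $\rho'\le0$.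
   Context: The metric is $ds^2=e^{\alpha(r)}dr^2+r^2(d\theta^2+\sin^2\theta\,d\varphi^2)-e^{\omega(r)}dt^2$; $p$, $\rho$ are matter pressure and density, $Q(r)$ the charge inside radius $r$, $\kappa>0$ a constant, $'=d/dr$. The total energy-momentum tensor has non-zero components $\kappa T^1{}_1=\kappa p-\frac{Q^2}{r^4}$, $\kappa T^2{}_2=\kappa T^3{}_3=\kappa p+\frac{Q^2}{r^4}$, $\kappa T^4{}_4=-\kappa\rho-\frac{Q^2}{r^4}$ (with $Q^2/r^4$ extended continuously to $r=0$). The constants $m,q,a$ are the total mass, total charge and radius of the body; the stated relations for $R,D,F$ and among $m,q,a$ express the matching at $r=a$ (continuity of $e^\alpha$, $e^\omega$, $\omega'$, and $Q(a)=\pm q$) to the Reissner–Nordström exterior $e^{-\alpha}=e^{\omega}=1-\frac{2m}r+\frac{q^2}{r^2}$. *)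

(* Defs.v *)
From Stdlib Require Import Reals Lra.
From Coquelicot Require Import Coquelicot.
Open Scope R_scope.

(** Static spherically symmetric charged fluids, in curvature coordinates, with
    metric  e^alpha dr^2 + r^2 (dtheta^2 + sin^2 theta dphi^2) - e^omega dt^2.
    A body of radius [a] only concerns [0 <= r <= a]. The radial functions are
    total, and all derivatives below are the two-sided ones of Coquelicot: at the
    end points they refer to the closed-form expressions, which for the solution
    studied here make sense on a neighbourhood of [[0, a]]. *)

Record charged_sphere := ChargedSphere {
  alpha : R -> R;
  omega : R -> R;
  pressure : R -> R;
  density : R -> R;
  charge : R -> R  (* the charge inside radius r *)
}.

(** Q^2/r^4, extended continuously to r = 0. *)
Definition field_term (S : charged_sphere) (r : R) : R :=
  if Req_EM_T r 0 then real (Lim (fun s => charge S s ^ 2 / s ^ 4) 0)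
  else charge S r ^ 2 / r ^ 4.

(** Mixed components T^i_i of the total energy-momentum tensor; all others vanish. *)
Definition T11 (kappa : R) (S : charged_sphere) (r : R) : R :=
  (kappa * pressure S r - field_term S r) / kappa.
Definition T22 (kappa : R) (S : charged_sphere) (r : R) : R :=
  (kappa * pressure S r + field_term S r) / kappa.
Definition T33 (kappa : R) (S : charged_sphere) (r : R) : R := T22 kappa S r.
Definition T44 (kappa : R) (S : charged_sphere) (r : R) : R :=
  (- (kappa * density S r) - field_term S r) / kappa.

(** Up to sign, the independent components of the Riemann tensor in the static
    orthonormal frame: those in the (t,r), (t,theta), (r,theta) and (theta,phi)
    planes. Every other component vanishes or equals one of these by symmetry. *)
Definition curv_tr (S : charged_sphere) (r : R) : R :=
  exp (- alpha S r) *
  (Derive_n (omega S) 2 r / 2 + Derive (omega S) r ^ 2 / 4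
   - Derive (alpha S) r * Derive (omega S) r / 4).
Definition curv_ttheta (S : charged_sphere) (r : R) : R :=
  exp (- alpha S r) * Derive (omega S) r / (2 * r).
Definition curv_rtheta (S : charged_sphere) (r : R) : R :=
  exp (- alpha S r) * Derive (alpha S) r / (2 * r).
Definition curv_thetaphi (S : charged_sphere) (r : R) : R :=
  (1 - exp (- alpha S r)) / r ^ 2.

(** Existence of the derivatives is required on a neighbourhood because
    [Derive] returns an arbitrary value where the function is not derivable. *)
Definition C2_at (f : R -> R) (r : R) : Prop :=
  locally r (fun s => ex_derive f s) /\
  locally r (fun s => ex_derive_n f 2 s) /\
  continuous (Derive_n f 2) r.

(** The center r = 0 is excluded from [curv_bounded] since spherical coordinates
    degenerate there; boundedness as r -> 0 is what rules out a singularity at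
    the center (a conical one in particular, through [curv_thetaphi]). *)
Definition curv_bounded (a : R) (K : R -> R) : Prop :=
  exists M : R, forall r : R, 0 < r <= a -> Rabs (K r) <= M.

(** Metric of class C^2 up to the center and the boundary, finite continuous
    matter and field variables, and no curvature singularity. *)
Definition nonsingular (a : R) (S : charged_sphere) : Prop :=
  (forall r : R, 0 <= r <= a -> C2_at (alpha S) r /\ C2_at (omega S) r) /\
  (forall r : R, 0 <= r <= a ->
     continuous (pressure S) r /\ continuous (density S) r /\
     continuous (charge S) r /\ continuous (field_term S) r) /\
  ex_finite_lim (fun s => charge S s ^ 2 / s ^ 4) 0 /\
  curv_bounded a (curv_tr S) /\ curv_bounded a (curv_ttheta S) /\
  curv_bounded a (curv_rtheta S) /\ curv_bounded a (curv_thetaphi S).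

(** The class Ia solution with A = 1/2; [s] is the sign of the charge.
    [alpha] is given by e^(-alpha) = 1 - r^2/R0^2, which only determines it where
    the right-hand side is positive, [ln] being 0 elsewhere. *)
Definition classIa (kappa R0 D F s : R) : charged_sphere := {|
  alpha := fun r => - ln (1 - r ^ 2 / R0 ^ 2);
  omega := fun r => sqrt 2 * (F - D * R0 ^ 2 * sqrt (1 - r ^ 2 / R0 ^ 2));
  pressure := fun r =>
    (- (1 / R0 ^ 2) + D ^ 2 * r ^ 2 / 4
     + sqrt 2 * D * sqrt (1 - r ^ 2 / R0 ^ 2)) / kappa;
  density := fun r => (3 / R0 ^ 2 - D ^ 2 * r ^ 2 / 4) / kappa;
  charge := fun r => s * (D * r ^ 3 / 2)
|}.

(* Main.v *)
(** Write W = sqrt (1 - r^2/R0^2). The matching relation between m, q and a says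
    exactly that the pressure vanishes at r = a, and it forces D * R0^2 <= 2 * sqrt 2.
    As D^2 r^2 / 4 = D^2 R0^2 (1 - W^2) / 4, the pressure is a concave quadratic
    polynomial in W, nondecreasing on W <= 1 because of that bound; since W decreases
    from 1 as r grows, the pressure decreases to 0 at the boundary. *)

Require Import Defs.
From Stdlib Require Import Reals Lra.
From Coquelicot Require Import Coquelicot.
Open Scope R_scope.

(** * Calculus of one real variable: second derivatives near a point *)

Lemma ex_derive_continuous_R (f : R -> R) (x : R) : ex_derive f x -> continuous f x.
Proof. exact (ex_derive_continuous f x). Qed.

Lemma locally_pos (f : R -> R) (x : R) :
  continuous f x -> 0 < f x -> locally x (fun y => 0 < f y).
Proof.
intros Hc Hp.
exact (Hc (fun y => 0 < y) (open_gt 0 (f x) Hp)).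
Qed.

Section SecondDerivative.

Variables (f f1 f2 : R -> R) (r : R).
Hypothesis (Hf : locally r (fun x => is_derive f x (f1 x))).
Hypothesis (Hf1 : locally r (fun x => is_derive f1 x (f2 x))).

(** The second derivative is the derivative of [Derive f], so [Derive f] must agree with [f1] on a
    whole neighbourhood of each [x]; [locally_locally] supplies this. *)
Lemma locally_is_derive_2 : locally r (fun x => is_derive_n f 2 x (f2 x)).
Proof.
generalize (locally_locally _ _ Hf); intros Hff.
generalize (filter_and _ _ Hff Hf1); apply filter_imp.
intros x [H1 H2]; simpl.
apply is_derive_ext_loc with f1; [|exact H2].
revert H1; apply filter_imp; intros y Hy.
symmetry; apply is_derive_unique, Hy.
Qed.

Lemma C2_at_of_is_derive : continuous f2 r -> C2_at f r.
Proof.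
intros Hc; split; [|split].
- revert Hf; apply filter_imp; intros x Hx; exists (f1 x); exact Hx.
- generalize locally_is_derive_2; apply filter_imp; intros x Hx.
  exists (f2 x); exact Hx.
- apply continuous_ext_loc with f2; [|exact Hc].
  generalize locally_is_derive_2; apply filter_imp; intros x Hx.
  symmetry; apply is_derive_n_unique, Hx.
Qed.

Lemma Derive_n_2_of_is_derive : Derive_n f 2 r = f2 r.
Proof.
apply is_derive_n_unique, (locally_singleton _ _ locally_is_derive_2).
Qed.

End SecondDerivative.

(** * Derivatives of the metric and matter functions of class Ia *)

Section ClassIa.

Variables (kappa R0 D F s : R).
Hypotheses (kappa_pos : 0 < kappa) (R0_pos : 0 < R0).

Let sol := classIa kappa R0 D F s.
Let U (r : R) := 1 - r ^ 2 / R0 ^ 2.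
Let W (r : R) := sqrt (U r).

Lemma sqr_sqrt_U r : 0 <= U r -> W r * W r = U r.
Proof. intros H; apply sqrt_sqrt, H. Qed.

Lemma sqrt_U_le_1 r : W r <= 1.
Proof.
unfold W; rewrite <- sqrt_1; apply sqrt_le_1_alt; unfold U.
assert (0 <= r ^ 2 / R0 ^ 2); [|lra].
apply Rdiv_le_0_compat; [apply pow2_ge_0|apply pow_lt, R0_pos].
Qed.

(** The derivatives in [C2_at] are two-sided, so the closed forms must hold slightly beyond each
    point, including past [r = a] and below [r = 0]. *)
Lemma locally_U_pos r : 0 < U r -> locally r (fun x => 0 < U x).
Proof.
apply locally_pos; apply ex_derive_continuous_R; unfold U.
auto_derive; trivial.
Qed.

Lemma is_derive_alpha r : 0 < U r ->
  is_derive (alpha sol) r (2 * r / R0 ^ 2 / U r).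
Proof.
unfold U; intros H; simpl alpha; auto_derive.
- exact H.
- unfold U; field; split; [lra|].
  intros E; apply (Rlt_irrefl 0); rewrite <- E at 2.
  replace (R0 ^ 2 - r ^ 2) with ((1 - r ^ 2 / R0 ^ 2) * R0 ^ 2) by (field; lra).
  apply Rmult_lt_0_compat; [exact H|apply pow_lt, R0_pos].
Qed.

Lemma is_derive_alpha1 r : 0 < U r ->
  is_derive (fun r => 2 * r / R0 ^ 2 / U r) r
    (2 / R0 ^ 2 / U r + 4 * r ^ 2 / R0 ^ 4 / U r ^ 2).
Proof.
intros H.
assert (E : R0 ^ 2 - r ^ 2 <> 0).
{ apply Rgt_not_eq.
  replace (R0 ^ 2 - r ^ 2) with (U r * R0 ^ 2) by (unfold U; field; lra).
  apply Rmult_lt_0_compat; [exact H|apply pow_lt, R0_pos]. }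
unfold U in *; auto_derive.
- apply Rgt_not_eq, H.
- field; split; [lra|exact E].
Qed.

Lemma is_derive_W r : 0 < U r -> is_derive W r (- r / R0 ^ 2 / W r).
Proof.
intros H.
assert (HW : 0 < W r) by (apply sqrt_lt_R0, H).
unfold W, U in *; auto_derive; [exact H|].
change (r * (r * 1)) with (r ^ 2); change (R0 * (R0 * 1)) with (R0 ^ 2).
unfold Rminus in *; unfold Rdiv in *; field; split; lra.
Qed.

Lemma is_derive_omega r : 0 < U r ->
  is_derive (omega sol) r (sqrt 2 * D * r / W r).
Proof.
intros H.
assert (HW : 0 < W r) by (apply sqrt_lt_R0, H).
change (omega sol) with (fun r => sqrt 2 * (F - D * R0 ^ 2 * W r)).
evar_last.
- apply @is_derive_scal, @is_derive_minus.
  + apply @is_derive_const.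
  + apply @is_derive_scal, is_derive_W, H.
- unfold minus, plus, opp, zero; simpl; field; lra.
Qed.

Lemma is_derive_omega1 r : 0 < U r ->
  is_derive (fun r => sqrt 2 * D * r / W r) r (sqrt 2 * D / W r ^ 3).
Proof.
intros H.
assert (HW : 0 < W r) by (apply sqrt_lt_R0, H).
evar_last.
- apply (is_derive_div (fun r => sqrt 2 * D * r) W r (sqrt 2 * D)).
  + auto_derive; trivial; ring.
  + apply is_derive_W, H.
  + lra.
(* The quotient rule produces the numerator [W^2 + r^2/R0^2], which equals 1; it is inserted here so
   that [field] can compare both sides. *)
- replace (sqrt 2 * D / W r ^ 3)
    with (sqrt 2 * D * (W r * W r + r ^ 2 / R0 ^ 2) / W r ^ 3).
  + field; lra.
  + rewrite sqr_sqrt_U by lra; unfold U; field; lra.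
Qed.

Lemma is_derive_pressure r : 0 < U r ->
  is_derive (pressure sol) r
    ((D ^ 2 * r / 2 - sqrt 2 * D * r / R0 ^ 2 / W r) / kappa).
Proof.
intros H.
assert (HW : 0 < W r) by (apply sqrt_lt_R0, H).
change (pressure sol) with (fun r =>
  (- (1 / R0 ^ 2) + D ^ 2 * r ^ 2 / 4 + sqrt 2 * D * W r) / kappa).
apply is_derive_ext with (fun r => / kappa *
  (- (1 / R0 ^ 2) + D ^ 2 * r ^ 2 / 4 + sqrt 2 * D * W r)).
{ intros t; apply Rmult_comm. }
evar_last.
- apply @is_derive_scal, @is_derive_plus.
  + instantiate (1 := D ^ 2 * r / 2); auto_derive; trivial; field; lra.
  + apply @is_derive_scal, is_derive_W, H.
- unfold plus; simpl; field; lra.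
Qed.

Lemma is_derive_density r :
  is_derive (density sol) r (- (D ^ 2 * r / 2) / kappa).
Proof. simpl density; auto_derive; trivial; field; lra. Qed.

Lemma C2_at_alpha r : 0 < U r -> C2_at (alpha sol) r.
Proof.
intros H.
apply C2_at_of_is_derive with (fun r => 2 * r / R0 ^ 2 / U r)
  (fun r => 2 / R0 ^ 2 / U r + 4 * r ^ 2 / R0 ^ 4 / U r ^ 2).
- generalize (locally_U_pos r H); apply filter_imp, is_derive_alpha.
- generalize (locally_U_pos r H); apply filter_imp, is_derive_alpha1.
- apply ex_derive_continuous_R; unfold U in *; auto_derive.
  repeat split;
    first [exact (Rgt_not_eq _ _ H) | exact (Rgt_not_eq _ _ (pow_lt _ 2 H))].
Qed.

Lemma omega_derivatives r : 0 < U r ->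
  C2_at (omega sol) r /\ Derive_n (omega sol) 2 r = sqrt 2 * D / W r ^ 3.
Proof.
intros H.
assert (H1 : locally r (fun r => is_derive (omega sol) r (sqrt 2 * D * r / W r))).
{ generalize (locally_U_pos r H); apply filter_imp, is_derive_omega. }
assert (H2 : locally r (fun r =>
  is_derive (fun r => sqrt 2 * D * r / W r) r (sqrt 2 * D / W r ^ 3))).
{ generalize (locally_U_pos r H); apply filter_imp, is_derive_omega1. }
split.
- apply (C2_at_of_is_derive _ _ _ _ H1 H2).
  assert (HW : 0 < W r) by (apply sqrt_lt_R0, H).
  apply ex_derive_continuous_R; unfold W, U in *; auto_derive.
  repeat split; [exact H|exact (Rgt_not_eq _ _ (pow_lt _ 3 HW))].
- exact (Derive_n_2_of_is_derive _ _ _ _ H1 H2).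
Qed.

(** * Curvature components in closed form *)

Lemma exp_opp_alpha r : 0 < U r -> exp (- alpha sol r) = U r.
Proof. intros H; simpl; rewrite Ropp_involutive; apply exp_ln, H. Qed.

(** With [e^(-alpha) = W^2], the contributions of [omega''] and [alpha' omega'] combine into a
    multiple of [(1 - r^2/R0^2)/W], which is [W]: no negative power of [W] survives. *)
Lemma curv_tr_classIa r : 0 < U r ->
  curv_tr sol r = sqrt 2 * D * W r / 2 + sqrt 2 ^ 2 * D ^ 2 * r ^ 2 / 4.
Proof.
intros H.
assert (HW : 0 < W r) by (apply sqrt_lt_R0, H).
assert (EU := sqr_sqrt_U r (Rlt_le _ _ H)).
unfold curv_tr; rewrite exp_opp_alpha by exact H.
rewrite (proj2 (omega_derivatives r H)).
rewrite (is_derive_unique _ _ _ (is_derive_omega r H)).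
rewrite (is_derive_unique _ _ _ (is_derive_alpha r H)).
rewrite <- EU.
transitivity (sqrt 2 * D * (1 - r ^ 2 / R0 ^ 2) / (2 * W r)
  + sqrt 2 ^ 2 * D ^ 2 * r ^ 2 / 4).
- field; lra.
- change (1 - r ^ 2 / R0 ^ 2) with (U r); rewrite <- EU; field; lra.
Qed.

Lemma curv_ttheta_classIa r : 0 < U r -> r <> 0 ->
  curv_ttheta sol r = sqrt 2 * D * W r / 2.
Proof.
intros H Hr.
assert (HW : 0 < W r) by (apply sqrt_lt_R0, H).
unfold curv_ttheta; rewrite exp_opp_alpha by exact H.
rewrite (is_derive_unique _ _ _ (is_derive_omega r H)).
rewrite <- (sqr_sqrt_U r) by lra; field; lra.
Qed.

Lemma curv_rtheta_classIa r : 0 < U r -> r <> 0 -> curv_rtheta sol r = 1 / R0 ^ 2.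
Proof.
intros H Hr.
unfold curv_rtheta; rewrite exp_opp_alpha by exact H.
rewrite (is_derive_unique _ _ _ (is_derive_alpha r H)); field; lra.
Qed.

Lemma curv_thetaphi_classIa r : 0 < U r -> r <> 0 -> curv_thetaphi sol r = 1 / R0 ^ 2.
Proof.
intros H Hr.
unfold curv_thetaphi; rewrite exp_opp_alpha by exact H.
unfold U; field; lra.
Qed.

(** * Electric field at the center and absence of singularities *)

Lemma is_lim_field : is_lim (fun r => charge sol r ^ 2 / r ^ 4) 0 0.
Proof.
set (f := fun r => s ^ 2 * D ^ 2 * r ^ 2 / 4).
apply is_lim_ext_loc with f.
(* The radius 1 is arbitrary: both expressions agree at every nonzero [y], and the limit ignores
   0. *)
- exists (mkposreal 1 Rlt_0_1); intros y _ Hy; unfold f; simpl; field; exact Hy.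
- evar_last.
  + apply (is_lim_continuity f), continuity_pt_filterlim, ex_derive_continuous_R.
    unfold f; auto_derive; trivial.
  + unfold f; f_equal; field.
Qed.

Lemma field_term_classIa r : field_term sol r = s ^ 2 * D ^ 2 * r ^ 2 / 4.
Proof.
unfold field_term; destruct (Req_EM_T r 0) as [->|Hr].
- rewrite (is_lim_unique _ _ _ is_lim_field); simpl; field.
- simpl; field; exact Hr.
Qed.

(** Everything reduces to positivity of [U] on the body: the curvatures then are constants or
    combinations of [W] and [r^2], bounded because [W <= 1] and [r <= a]. *)
Lemma nonsingular_classIa a :
  (forall r, 0 <= r <= a -> 0 < U r) -> nonsingular a sol.
Proof.
intros HU.
assert (Bnd : forall r, 0 < r <= a -> Rabs (sqrt 2 * D * W r / 2) <= Rabs (sqrt 2 * D / 2)).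
{ intros r Hr.
  replace (sqrt 2 * D * W r / 2) with (sqrt 2 * D / 2 * W r) by field.
  rewrite Rabs_mult, (Rabs_pos_eq (W r)) by apply sqrt_pos.
  rewrite <- (Rmult_1_r (Rabs (sqrt 2 * D / 2))) at 2.
  apply Rmult_le_compat_l; [apply Rabs_pos|apply sqrt_U_le_1]. }
split; [|split; [|split; [|split; [|split; [|split]]]]].
- intros r Hr; split; [apply C2_at_alpha|apply omega_derivatives]; apply HU, Hr.
- intros r Hr; split; [|split; [|split]].
  + apply ex_derive_continuous_R; eexists; apply is_derive_pressure, HU, Hr.
  + apply ex_derive_continuous_R; eexists; apply is_derive_density.
  + apply ex_derive_continuous_R; simpl charge; auto_derive; trivial.
  + apply continuous_ext with (fun r => s ^ 2 * D ^ 2 * r ^ 2 / 4).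
    { intros t; symmetry; apply field_term_classIa. }
    apply ex_derive_continuous_R; auto_derive; trivial.
- exists 0; exact is_lim_field.
- exists (Rabs (sqrt 2 * D / 2) + sqrt 2 ^ 2 * D ^ 2 * a ^ 2 / 4); intros r Hr.
  rewrite curv_tr_classIa by (apply HU; lra).
  eapply Rle_trans; [apply Rabs_triang|].
  apply Rplus_le_compat; [apply Bnd, Hr|].
  rewrite Rabs_pos_eq.
  + apply Rmult_le_compat_r; [lra|]; apply Rmult_le_compat_l.
    * rewrite <- Rpow_mult_distr; apply pow2_ge_0.
    * apply pow_incr; lra.
  + rewrite <- !Rpow_mult_distr; apply Rdiv_le_0_compat; [apply pow2_ge_0|lra].
- exists (Rabs (sqrt 2 * D / 2)); intros r Hr.
  rewrite curv_ttheta_classIa by (try apply HU; lra); apply Bnd, Hr.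
- exists (Rabs (1 / R0 ^ 2)); intros r Hr.
  rewrite curv_rtheta_classIa by (try apply HU; lra); apply Rle_refl.
- exists (Rabs (1 / R0 ^ 2)); intros r Hr.
  rewrite curv_thetaphi_classIa by (try apply HU; lra); apply Rle_refl.
Qed.

Lemma derivatives_at_center :
  is_derive (alpha sol) 0 0 /\ is_derive (omega sol) 0 0 /\
  is_derive (pressure sol) 0 0.
Proof.
assert (U0 : U 0 = 1) by (unfold U; field; lra).
assert (W0 : W 0 = 1) by (unfold W; rewrite U0; apply sqrt_1).
assert (H : 0 < U 0) by lra.
split; [|split]; evar_last.
- apply is_derive_alpha, H.
- rewrite U0; field; lra.
- apply is_derive_omega, H.
- rewrite W0; field.
- apply is_derive_pressure, H.
- rewrite W0; field; lra.
Qed.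

End ClassIa.

(** * Algebra of the matching at the boundary *)

(** The first claim is positivity of the exterior coefficient [1 - 2m/a + q^2/a^2], equal to
    [1 - a^2/R0^2]. The third, which will give the sign of the density, comes from [m > q^2/a]. The
    fourth, which controls the monotonicity of the pressure, also uses [|q| <= m]. *)
Lemma matching_relations (a m q R0 D : R) (ha : 0 < a) (hq : q <> 0)
  (hpos : 0 < 1 - 2 * m / a + q ^ 2 / a ^ 2)
  (hm : m > q ^ 2 / a)
  (hmqa : (m / q) ^ 2 - 1 = 1 / 2 * (m / q - q / a) ^ 2)
  (hR0 : 0 < R0)
  (hR : 1 / R0 ^ 2 = 2 / a ^ 3 * (m - q ^ 2 / (2 * a)))
  (hD : D = 2 * Rabs q / a ^ 3) :
  let Wa := sqrt (1 - a ^ 2 / R0 ^ 2) in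
  0 < 1 - a ^ 2 / R0 ^ 2 /\ 0 < D /\ D ^ 2 * a ^ 2 / 4 <= 1 / R0 ^ 2 /\
  D <= 2 * sqrt 2 * (1 / R0 ^ 2) /\
  - (1 / R0 ^ 2) + D ^ 2 * a ^ 2 / 4 + sqrt 2 * D * Wa = 0.
Proof.
intros Wa.
(* In units of [a], [1 / R0^2] becomes [2u - g^2] and [D] becomes [2g]. *)
set (u := m / a); set (g := Rabs q / a).
assert (Hq : 0 < Rabs q) by (apply Rabs_pos_lt, hq).
assert (Hg : 0 < g) by (apply Rdiv_lt_0_compat; lra).
assert (Eg : g ^ 2 = q ^ 2 / a ^ 2).
{ unfold g; rewrite <- (pow2_abs q); field; lra. }
assert (EU : a ^ 2 / R0 ^ 2 = 2 * u - g ^ 2).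
{ replace (a ^ 2 / R0 ^ 2) with (a ^ 2 * (1 / R0 ^ 2)) by (field; lra).
  rewrite hR, Eg; unfold u; field; lra. }
assert (HR : 1 / R0 ^ 2 = (2 * u - g ^ 2) / a ^ 2).
{ rewrite <- EU; field; lra. }
assert (HD : D = 2 * g / a ^ 2) by (rewrite hD; unfold g; field; lra).
assert (Hu : g ^ 2 < u).
{ rewrite Eg; unfold u.
  replace (q ^ 2 / a ^ 2) with (q ^ 2 / a / a) by (field; lra).
  apply Rmult_lt_compat_r; [apply Rinv_0_lt_compat|]; lra. }
(* This is [hmqa] multiplied by [2 * q^2 / a^2]. *)
assert (E : 2 * (u ^ 2 - g ^ 2) = (u - g ^ 2) ^ 2).
{ rewrite Eg; unfold u.
  transitivity (2 * (q ^ 2 / a ^ 2) * ((m / q) ^ 2 - 1)); [field; lra|].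
  rewrite hmqa; field; lra. }
assert (Hpos : 0 < 1 - 2 * u + g ^ 2).
{ rewrite Eg; unfold u.
  replace (1 - 2 * (m / a)) with (1 - 2 * m / a) by (field; lra); exact hpos. }
clearbody u g; clear hm hmqa hR hD hpos Eg.
assert (H2 : 0 < sqrt 2) by (apply sqrt_lt_R0; lra).
assert (E2 : sqrt 2 ^ 2 = 2) by (apply pow2_sqrt; lra).
assert (Ha2 : 0 < a ^ 2) by (apply pow_lt, ha).
assert (Hg2 : 0 < g ^ 2) by (apply pow_lt, Hg).
(* By [E], [u^2 - g^2] is half a square. *)
assert (Hgu : g <= u).
{ apply Rsqr_incr_0_var; [|lra]; rewrite !Rsqr_pow2.
  generalize (pow2_ge_0 (u - g ^ 2)); lra. }
split; [lra|]; split; [|split; [|split]].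
- rewrite HD; apply Rdiv_lt_0_compat; lra.
- rewrite HR, HD.
  replace ((2 * g / a ^ 2) ^ 2 * a ^ 2 / 4) with (g ^ 2 / a ^ 2) by (field; lra).
  apply Rmult_le_compat_r; [apply Rlt_le, Rinv_0_lt_compat|]; lra.
- rewrite HR, HD.
  replace (2 * sqrt 2 * ((2 * u - g ^ 2) / a ^ 2))
    with (2 * sqrt 2 * (2 * u - g ^ 2) / a ^ 2) by (field; lra).
  apply Rmult_le_compat_r; [apply Rlt_le, Rinv_0_lt_compat; lra|].
  (* The chain is [g <= u < 2u - g^2 <= sqrt 2 * (2u - g^2)]. *)
  assert (1 <= sqrt 2) by (rewrite <- sqrt_1; apply sqrt_le_1_alt; lra).
  nra.
- (* both sides of [2 sqrt 2 g Wa = 2 (u - g^2)] are nonnegative, and their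
     squares agree by [E] *)
  assert (EW : sqrt 2 * g * Wa = u - g ^ 2).
  { assert (HWa : 0 <= Wa) by apply sqrt_pos.
    apply Rsqr_inj; [|lra|].
    - repeat apply Rmult_le_pos; lra.
    - rewrite !Rsqr_pow2, !Rpow_mult_distr, E2.
      unfold Wa; rewrite pow2_sqrt by lra; rewrite EU; nra. }
  rewrite HR, HD.
  replace (sqrt 2 * (2 * g / a ^ 2) * Wa) with (2 * (sqrt 2 * g * Wa) / a ^ 2)
    by (field; lra).
  rewrite EW; field; lra.
Qed.

(** * Regularity and energy conditions on the body *)

Theorem mainTheorem10 (kappa a m q R0 D F s : R)
  (hkappa : 0 < kappa) (ha : 0 < a) (hq : q <> 0)
  (hpos : 0 < 1 - 2 * m / a + q ^ 2 / a ^ 2)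
  (hm : m > q ^ 2 / a)
  (hmqa : (m / q) ^ 2 - 1 = 1 / 2 * (m / q - q / a) ^ 2)
  (hR0 : 0 < R0)
  (hR : 1 / R0 ^ 2 = 2 / a ^ 3 * (m - q ^ 2 / (2 * a)))
  (hD : D = 2 * Rabs q / a ^ 3)
  (hF : sqrt 2 * (F - D * R0 ^ 2 * sqrt (1 - a ^ 2 / R0 ^ 2))
        = ln (1 - 2 * m / a + q ^ 2 / a ^ 2))
  (hs : s = 1 \/ s = - 1) :
  let sol := classIa kappa R0 D F s in
  (* the metric functions are well defined, and the solution is non-singular *)
  (forall r : R, 0 <= r <= a ->
     0 < 1 - r ^ 2 / R0 ^ 2 /\ exp (- alpha sol r) = 1 - r ^ 2 / R0 ^ 2) /\
  nonsingular a sol /\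
  (* no horizons *)
  (forall r : R, 0 <= r <= a -> 0 < exp (omega sol r)) /\
  (* regularity conditions *)
  (is_derive (alpha sol) 0 0 /\ is_derive (omega sol) 0 0 /\
   is_derive (pressure sol) 0 0) /\
  (* energy conditions (i)-(viii) *)
  (forall r : R, 0 <= r <= a ->
     - T44 kappa sol r >= 0 /\
     pressure sol r + density sol r >= 0 /\
     (T11 kappa sol r + T22 kappa sol r + T33 kappa sol r) - T44 kappa sol r >= 0 /\
     density sol r >= 0 /\
     pressure sol r >= 0 /\
     3 * pressure sol r + density sol r >= 0 /\
     (ex_derive (pressure sol) r /\ Derive (pressure sol) r <= 0) /\
     (ex_derive (density sol) r /\ Derive (density sol) r <= 0)).
Proof.
intros sol.
destruct (matching_relations a m q R0 D ha hq hpos hm hmqa hR0 hR hD)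
  as (HUa & HD & HDR & HDle & Hpa).
set (Wa := sqrt (1 - a ^ 2 / R0 ^ 2)) in Hpa.
clear hq hpos hm hmqa hR hD hF.
assert (Hs2 : s ^ 2 = 1) by (destruct hs as [-> | ->]; ring).
assert (HR2 : 0 < R0 ^ 2) by (apply pow_lt, hR0).
assert (HiR2 : 0 < 1 / R0 ^ 2) by (apply Rdiv_lt_0_compat; lra).
assert (H2 : 0 < sqrt 2) by (apply sqrt_lt_R0; lra).
assert (Hsq : forall r, 0 <= r <= a -> 0 <= r ^ 2 <= a ^ 2).
{ intros r Hr; split; [apply pow2_ge_0|apply pow_incr, Hr]. }
assert (HUle : forall r, 0 <= r <= a -> 1 - a ^ 2 / R0 ^ 2 <= 1 - r ^ 2 / R0 ^ 2).
{ intros r Hr; apply Rplus_le_compat_l, Ropp_le_contravar.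
  apply Rmult_le_compat_r; [apply Rlt_le, Rinv_0_lt_compat, HR2|apply Hsq, Hr]. }
assert (HU : forall r, 0 <= r <= a -> 0 < 1 - r ^ 2 / R0 ^ 2).
{ intros r Hr; eapply Rlt_le_trans; [exact HUa|apply HUle, Hr]. }
split; [|split; [|split; [|split]]].
- intros r Hr; split; [|apply exp_opp_alpha]; apply HU, Hr.
- apply nonsingular_classIa; assumption.
(* The substance lies in the first conjunct: [1 - r^2/R0^2 > 0] keeps the square root in [omega]
   meaningful. *)
- intros r _; apply exp_pos.
- apply derivatives_at_center; assumption.
- intros r Hr.
  assert (HUr := HU r Hr).
  set (W := sqrt (1 - r ^ 2 / R0 ^ 2)).
  assert (HW : 0 < W) by (apply sqrt_lt_R0, HUr).
  assert (HW1 : W <= 1) by apply (sqrt_U_le_1 _ hR0).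
  assert (HWW : Wa <= W) by (apply sqrt_le_1_alt, HUle, Hr).
  assert (HWr : r ^ 2 = R0 ^ 2 * (1 - W * W)).
  { unfold W; rewrite sqrt_sqrt by lra; field; lra. }
  assert (HWa : a ^ 2 = R0 ^ 2 * (1 - Wa * Wa)).
  { unfold Wa; rewrite sqrt_sqrt by lra; field; lra. }
  assert (HDR2 : D * R0 ^ 2 <= 2 * sqrt 2).
  { replace (2 * sqrt 2) with (2 * sqrt 2 * (1 / R0 ^ 2) * R0 ^ 2) by (field; lra).
    apply Rmult_le_compat_r; lra. }
  (* [f] is both the field term [Q^2/r^4], since [s^2 = 1], and the varying polynomial part of
     [kappa p] and [kappa rho]. *)
  set (f := D ^ 2 * r ^ 2 / 4).
  assert (Hf : 0 <= f <= 1 / R0 ^ 2).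
  { assert (HD2 : 0 < D ^ 2) by (apply pow_lt, HD).
    assert (H := Hsq r Hr); unfold f; split; [nra|].
    eapply Rle_trans; [|exact HDR]; nra. }
  set (kp := - (1 / R0 ^ 2) + f + sqrt 2 * D * W).
  assert (Hkp : 0 <= kp).
  (* The 0 is replaced by the pressure at [a]; the difference of the two values is a quarter of the
     product below, whose last factor is nonnegative since [W + Wa <= 2] and
     [D * R0^2 <= 2 * sqrt 2]. *)
  { rewrite <- Hpa; unfold kp, f; rewrite HWr, HWa.
    assert (0 <= (W - Wa) * D * (4 * sqrt 2 - D * R0 ^ 2 * (W + Wa))); [|nra].
    repeat apply Rmult_le_pos; [lra|lra|].
    assert (0 <= D * R0 ^ 2) by (apply Rmult_le_pos; lra).
    nra. }
  set (p := pressure sol r); set (rho := density sol r).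
  assert (Hp : kappa * p = kp).
  { unfold p, kp, f, W; simpl; field; lra. }
  assert (Hrho : kappa * rho = 3 / R0 ^ 2 - f).
  { unfold rho, f; simpl; field; lra. }
  assert (Hrho0 : 0 <= kappa * rho).
  { rewrite Hrho; replace (3 / R0 ^ 2) with (3 * (1 / R0 ^ 2)) by (field; lra); lra. }
  assert (Hp_ge : 0 <= p).
  { apply Rmult_le_reg_l with kappa; [exact hkappa|lra]. }
  assert (Hrho_ge : 0 <= rho).
  { apply Rmult_le_reg_l with kappa; [exact hkappa|lra]. }
  assert (Hfield : field_term sol r = f).
  { unfold sol; rewrite field_term_classIa, Hs2; unfold f; field. }
  unfold T33, T11, T22, T44; rewrite Hfield; fold p rho.
  (* Conditions (ii), (iv), (v) and (vi) follow at once from [p >= 0] and [rho >= 0]. *)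
  repeat split; try lra.
  + apply Rle_ge.
    replace (- ((- (kappa * rho) - f) / kappa)) with (rho + f / kappa)
      by (field; lra).
    apply Rplus_le_le_0_compat; [lra|apply Rdiv_le_0_compat; lra].
  + apply Rle_ge.
    (* In the spatial trace the field terms add up to one [f], and [- T44] contributes another. *)
    match goal with |- 0 <= ?x =>
      replace x with (3 * p + rho + 2 * (f / kappa)) by (field; lra) end.
    assert (0 <= f / kappa) by (apply Rdiv_le_0_compat; lra).
    lra.
  + eexists; apply is_derive_pressure; assumption.
  + unfold sol; rewrite (is_derive_unique _ _ _
      (is_derive_pressure kappa R0 D F s hkappa hR0 r HUr)); fold W.
    (* Factored this way, the sign of [p'] rests on [D * R0^2 * W <= 2 * sqrt 2]. *)
    replace ((D ^ 2 * r / 2 - sqrt 2 * D * r / R0 ^ 2 / W) / kappa)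
      with (- (r * D * (2 * sqrt 2 - D * R0 ^ 2 * W) / (2 * R0 ^ 2 * W * kappa)))
      by (field; lra).
    assert (0 <= D * R0 ^ 2) by (apply Rmult_le_pos; lra).
    apply Ropp_le_cancel; rewrite Ropp_0, Ropp_involutive.
    apply Rdiv_le_0_compat.
    * repeat apply Rmult_le_pos; [lra|lra|nra].
    * repeat apply Rmult_lt_0_compat; lra.
  + eexists; apply is_derive_density; assumption.
  + unfold sol; rewrite (is_derive_unique _ _ _
      (is_derive_density kappa R0 D F s hkappa r)).
    assert (0 <= D ^ 2 * r / 2 / kappa).
    { repeat apply Rmult_le_pos; try lra; apply Rlt_le, Rinv_0_lt_compat; lra. }
    lra.
Qed.
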